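(* Let $\mathbf n=(n_1,\ldots,n_k)\in\mathbb N^k$ with $n_i\ge2$ for all $i$. For every $m\in\mathbb N$ and every $t\in[0,m]$ there exists a pure element $\mathbf T$ in the polyball $\mathbf B_{\mathbf n}$ with $\mathrm{rank}(\mathbf T)=m$ and $\chi(\mathbf T)=t$. Consequently, the range of the Euler characteristic (on elements of $\mathbf B_{\mathbf n}$ with finite rank defect) coincides with the interval $[0,\infty)$.
   Context: All Hilbert spaces are complex. $B(\mathcal H)^{n_1}\times_c\cdots\times_cB(\mathcal H)^{n_k}$ is the set of tuples $\mathbf X=(X_1,\ldots,X_k)$, $X_i=(X_{i,1},\ldots,X_{i,n_i})\in B(\mathcal H)^{n_i}$, such that every entry of $X_s$ commutes with every entry of $X_t$ for $s\ne t$ (entries of one $X_i$ need not commute). $\Phi_{X_i}(Y):=\sum_{j=1}^{n_i}X_{i,j}YX_{i,j}^*$, and for $\mathbf p\in\{0,1\}^k$, $\mathbf\Delta_{\mathbf X}^{\mathbf p}:=(id-\Phi_{X_1})^{p_1}\circ\cdots\circ(id-\Phi_{X_k})^{p_k}$. $\mathbf B_{\mathbf n}(\mathcal H)$ is the set of such $\mathbf X$ with $\mathbf\Delta_{\mathbf X}^{\mathbf p}(I)\ge0$ for all $\mathbf p\in\{0,1\}^k$, and $\mathbf B_{\mathbf n}=\{\mathbf B_{\mathbf n}(\mathcal H):\mathcal H\text{ a Hilbert space}\}$; an element of $\mathbf B_{\mathbf n}$ is an element of some $\mathbf B_{\mathbf n}(\mathcal H)$. $\mathbf X$ is pure if $\Phi_{X_i}^p(I)\to0$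 strongly as $p\to\infty$ for each $i$. The defect operator is $\mathbf\Delta_{\mathbf X}(I):=(id-\Phi_{X_1})\circ\cdots\circ(id-\Phi_{X_k})(I)$, and $\mathrm{rank}(\mathbf X)$ is the rank of $\mathbf\Delta_{\mathbf X}(I)$. $\mathbb F_{n_i}^+$ is the unital free semigroup on generators $g_1^i,\ldots,g_{n_i}^i$ with identity $g_0^i$, $|\alpha|$ denotes word length, $X_{i,\alpha}:=X_{i,j_1}\cdots X_{i,j_p}$ for $\alpha=g^i_{j_1}\cdots g^i_{j_p}$, $X_{i,g_0^i}:=I$. For $\mathbf q\in\mathbb Z_+^k$, $M_{\mathbf q}(\mathbf X):=\mathrm{span}\{X_{1,\alpha_1}\cdots X_{k,\alpha_k}h:|\alpha_i|\le q_i,\ h\in\mathbf\Delta_{\mathbf X}(I)(\mathcal H)\}$. The Euler characteristic of $\mathbf X$ with finite rank defect is $$\chi(\mathbf X):=\lim_{m\to\infty}\frac{\dim M_{\mathbf q^{(m)}}(\mathbf X)}{\prod_{i=1}^k(1+n_i+\cdots+n_i^{q_i^{(m)}})}$$ for any increasing cofinal sequence $\mathbf q^{(m)}$ in $\mathbb Z_+^k$ (the limit exists and is independent of the sequence). *)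

(* Defs.v *)
From HB Require Import structures.
From mathcomp Require Import all_boot all_order all_algebra.
From mathcomp Require Import complex.
From mathcomp Require Import all_classical all_reals all_analysis.

Set Implicit Arguments.
Unset Strict Implicit.
Unset Printing Implicit Defensive.

Import Order.TTheory GRing.Theory Num.Theory numFieldNormedType.Exports.

Local Open Scope classical_set_scope.
Local Open Scope ring_scope.
Local Open Scope complex_scope.

(* The inner product is linear in its first argument and conjugate-linear in
   the second; it determines the norm of the underlying Banach space. *)
Record hilbertType (R : realType) := HilbertType {
  hilbert_space :> completeNormedModType R[i];
  inner : {dot hilbert_space for Num.conj};
  inner_norm : forall x : hilbert_space, `|x| ^+ 2 = inner x x
}.

Record boundedOp (R : realType) (H : hilbertType R) := BoundedOp {
  bop_fun :> {linear H -> H};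
  bop_bounded : exists M : R[i], forall x : H, `|bop_fun x| <= M * `|x|
}.

(* The value at [y] is the z such that <A x, y> = <x, z> for all x; for bounded
   [A] it exists and is unique by the Riesz representation theorem, and for
   other [A] the default value 0 may be returned. *)
Definition adjoint (R : realType) (H : hilbertType R) (A : H -> H) : H -> H :=
  fun y => xget 0 [set z | forall x : H, inner H (A x) y = inner H x z].

(* [0 <= z] in [R[i]] means that z is real and nonnegative. *)
Definition positive_op (R : realType) (H : hilbertType R) (A : H -> H) : Prop :=
  forall h : H, 0 <= inner H (A h) h.

Section Dimension.
Variables (K : fieldType) (V : lmodType K).

Definition lin_span (S : set V) : set V :=
  [set v | exists (d : nat) (c : 'I_d -> K) (s : 'I_d -> V),
    (forall i, S (s i)) /\ v = \sum_(i < d) c i *: s i].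

Definition lin_indep (d : nat) (b : 'I_d -> V) : Prop :=
  forall c : 'I_d -> K, \sum_(i < d) c i *: b i = 0 -> forall i, c i = 0.

Definition has_dim (W : set V) (d : nat) : Prop :=
  exists b : 'I_d -> V, lin_indep b /\ lin_span (range b) = W.

Definition finite_dim (W : set V) : Prop := exists d, has_dim W d.

(* Only meaningful when [finite_dim W]; the value is 0 otherwise. *)
Definition lin_dim (W : set V) : nat := xget 0%N (has_dim W).

End Dimension.

(* [X i] is an element of B(H)^(n_i). *)
Definition opTuple (R : realType) (H : hilbertType R) (k : nat)
    (n : 'I_k -> nat) : Type :=
  forall i : 'I_k, 'I_(n i) -> boundedOp H.

Section Polyball.
Variables (R : realType) (H : hilbertType R) (k : nat) (n : 'I_k -> nat).
Variable X : opTuple H n.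
Arguments X : clear implicits.

Definition cross_commuting : Prop :=
  forall (s t : 'I_k), s != t -> forall (a : 'I_(n s)) (b : 'I_(n t)) (h : H),
    X s a (X t b h) = X t b (X s a h).

Definition Phi (i : 'I_k) (Y : H -> H) : H -> H :=
  fun h => \sum_(j < n i) X i j (Y (adjoint (X i j) h)).

Definition Delta (p : 'I_k -> bool) : (H -> H) -> (H -> H) :=
  \big[comp/id]_(i < k) iter (p i) (fun Y : H -> H => Y \- Phi i Y).

Definition polyball : Prop :=
  cross_commuting /\ forall p : 'I_k -> bool, positive_op (Delta p id).

Definition pure : Prop :=
  forall (i : 'I_k) (h : H), iter p (Phi i) id h @[p --> \oo] --> (0 : H).

Definition defect : H -> H := Delta (fun=> true) id.

Definition finite_rank : Prop := finite_dim (range defect).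

Definition rank : nat := lin_dim (range defect).

(* Words over the n_i generators are sequences; [::] is the empty word. *)
Definition word_op (i : 'I_k) (w : seq 'I_(n i)) : H -> H :=
  foldr (fun j f => X i j \o f) id w.

Definition Mspan (q : 'I_k -> nat) : set H :=
  lin_span [set v | exists (alpha : forall i : 'I_k, seq 'I_(n i)) (h : H),
    [/\ forall i, (size (alpha i) <= q i)%N,
        range defect h &
        v = (\big[comp/id]_(i < k) word_op (alpha i)) h]].

Definition euler_ratio (q : 'I_k -> nat) : R :=
  (lin_dim (Mspan q))%:R / \prod_(i < k) \sum_(j < (q i).+1) (n i)%:R ^+ j.

End Polyball.

Definition increasing_cofinal (k : nat) (q : nat -> 'I_k -> nat) : Prop :=
  (forall m i, (q m i <= q m.+1 i)%N) /\
  (forall r : 'I_k -> nat, exists m, forall i, (r i <= q m i)%N).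

(* The graph of the Euler characteristic: the limit along every increasing
   cofinal sequence exists and equals [t]. *)
Definition euler_char_is (R : realType) (H : hilbertType R) (k : nat)
    (n : 'I_k -> nat) (X : opTuple H n) (t : R) : Prop :=
  forall q : nat -> 'I_k -> nat, increasing_cofinal q ->
    euler_ratio X (q m) @[m --> \oo] --> t.

(* Main.v *)
From HB Require Import structures.
Require Import Defs.
From mathcomp Require Import all_boot all_order all_algebra finmap.
From mathcomp Require Import complex.
From mathcomp Require Import all_classical all_reals all_analysis.
From mathcomp Require Import summability zify ring.

Import Order.TTheory GRing.Theory Num.Theory numFieldNormedType.Exports.

Set Implicit Arguments.
Unset Strict Implicit.
Unset Printing Implicit Defensive.

Local Open Scope complex_scope.
Local Open Scope classical_set_scope.
Local Open Scope ring_scope.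

#[local] Existing Instance totally_filter.

(** The full Fock space model has as orthonormal basis the labels (c, w), where
    c < m numbers a copy and w is a family of words, one for each coordinate i;
    the left creation operators add a letter in front of the i-th word. If a set
    P of labels is closed under deleting the first letter of any word, then the
    closed span of P is invariant under the adjoints, and the compressions of the
    creation operators to it ([model]) form a pure element of the polyball
    ([model_polyball], [model_pure]): each Phi_i maps the diagonal projection onto
    a set of labels to the diagonal projection onto the labels whose i-th word is
    not empty and which fall into the set once the first letter of this word is
    deleted ([Phi_projl]). The defect operator is the projection onto the labels in P
    all of whose words are empty, and the space M_q is spanned by the labels in P
    whose words are no longer than q_i ([has_dim_defect], [has_dim_Mspan]). So the
    rank and the Euler characteristic become a counting matter.

    Given t in [0, m], let P restrict only the word w of the first coordinate, by
    the condition that w is empty or that c + 0.w < t, where 0.w is the base n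
    fraction whose first digit is the last letter of w ([below]). Deleting the
    first letter of w drops the last digit, so P is closed as required. All m
    vacua are in P, so the rank is m. For l > 0 the pairs (c, w) with w of length
    l correspond to the integers v < m n^l, and the condition becomes
    v < t n^l; hence between t n^l and t n^l + 1 of them are in P
    ([card_below_level]). The other coordinates cancel in the Euler ratio, which
    therefore differs from t by at most (m + q) / (1 + n + ... + n^q), and this
    tends to zero since n > 1 ([ratio_cvg]).

    The range contains every t >= 0 by taking m above t, and contains nothing
    else because Euler ratios are nonnegative.

    The Hilbert space is the space [l2] of square-summable families over an
    arbitrary index type. Its inner product is a limit of finite sums, which
    converge by polarization because sums of squares are monotone and bounded.
    The operators permute basis vectors partially, and their adjoints are given
    by the inverse partial bijections ([adjoint_pshift]). *)

(** * The Hilbert space of square-summable families *)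

Section NormSq.
Variable R : realType.
Implicit Types a b z : R[i].

Definition nsq z : R := complex.Re z ^+ 2 + complex.Im z ^+ 2.

Lemma nsqE z : (nsq z)%:C = z * z^*.
Proof. by rewrite /nsq add_Re2_Im2 normCK. Qed.

Lemma nsq_ge0 z : 0 <= nsq z.
Proof. by rewrite addr_ge0 ?sqr_ge0. Qed.

Lemma nsq0 : nsq 0 = 0.
Proof. by rewrite /nsq /= expr0n addr0. Qed.

Lemma nsq_eq0 z : nsq z = 0 -> z = 0.
Proof.
move=> h; have := nsqE z; rewrite h -normCK => /esym/eqP.
by rewrite expf_eq0 /= normr_eq0 => /eqP.
Qed.

Lemma nsqM a b : nsq (a * b) = nsq a * nsq b.
Proof. by case: a b => [a1 a2] [b1 b2]; rewrite /nsq /=; ring. Qed.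

Lemma posc_real (e : R[i]) : 0 < e -> exists2 r : R, 0 < r & e = r%:C.
Proof.
case: e => a b; rewrite ltcE /= => /andP[/eqP -> a0].
by exists a.
Qed.

Lemma nsqN a : nsq (- a) = nsq a.
Proof. by case: a => [a1 a2]; rewrite /nsq /= !sqrrN. Qed.

(** The difference of the two sides is [e^-1] times the squared modulus of
    [e * a - b]. *)
Lemma nsqD_weighted a b (e : R) : 0 < e ->
  nsq (a + b) <= (1 + e) * nsq a + (1 + e^-1) * nsq b.
Proof.
move=> e0; case: a b => [a1 a2] [b1 b2]; rewrite /nsq /=.
rewrite -subr_ge0.
suff -> : (1 + e) * (a1 ^+ 2 + a2 ^+ 2) + (1 + e^-1) * (b1 ^+ 2 + b2 ^+ 2)
  - ((a1 + b1) ^+ 2 + (a2 + b2) ^+ 2)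
  = e^-1 * ((e * a1 - b1) ^+ 2 + (e * a2 - b2) ^+ 2).
  by apply: mulr_ge0; rewrite ?invr_ge0 ?(ltW e0) // addr_ge0 ?sqr_ge0.
by field; rewrite gt_eqF.
Qed.

Lemma nsqD_le a b : nsq (a + b) <= 2 * nsq a + 2 * nsq b.
Proof. by have := @nsqD_weighted a b 1 ltr01; rewrite invr1. Qed.

End NormSq.

Section SquareSummable.
Variables (R : realType) (I : choiceType).

Definition square_summable : {pred I -> R[i]} :=
  fun f => `[< exists M : R, forall s : {fset I},
                \sum_(x <- s) nsq (f x) <= M >].

Lemma square_summable_submod : submod_closed square_summable.
Proof.
split; first by apply/asboolP; exists 0 => s; rewrite big1 // => x _; rewrite nsq0.
move=> a f g /asboolP[M fM] /asboolP[N gN]; apply/asboolP.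
exists (2 * (nsq a * M) + 2 * N) => s.
apply: (@le_trans _ _ (\sum_(x <- s) (2 * (nsq a * nsq (f x)) + 2 * nsq (g x)))).
  by apply: ler_sum => x _; rewrite -nsqM; exact: nsqD_le.
rewrite big_split /= -!mulr_sumr lerD // ler_wpM2l // ler_wpM2l ?nsq_ge0 //.
Qed.

HB.instance Definition _ :=
  GRing.isSubmodClosed.Build R[i] (I -> R[i]) square_summable
    square_summable_submod.

Record l2 := L2 { l2val :> I -> R[i]; l2valP : l2val \in square_summable }.

HB.instance Definition _ := [isSub for l2val].
HB.instance Definition _ := [Choice of l2 by <:].
HB.instance Definition _ := [SubChoice_isSubLmodule of l2 by <:].

Lemma l2_eqP (f g : l2) : (forall x, f x = g x) -> f = g.
Proof. by move=> fg; apply: val_inj; apply/funext. Qed.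

Lemma l2D (f g : l2) x : (f + g : l2) x = f x + g x. Proof. by []. Qed.
Lemma l2N (f : l2) x : (- f : l2) x = - f x. Proof. by []. Qed.
Lemma l2Z a (f : l2) x : (a *: f : l2) x = a * f x. Proof. by []. Qed.
Lemma l20 x : (0 : l2) x = 0. Proof. by []. Qed.
Lemma l2_sum J (r : seq J) (P : pred J) (F : J -> l2) x :
  (\sum_(j <- r | P j) F j : l2) x = \sum_(j <- r | P j) F j x.
Proof.
by elim/big_rec2: _ => //= j y f Pj <-.
Qed.

End SquareSummable.

Arguments l2val : simpl never.

Section NormSquared.
Variables (R : realType) (I : choiceType).
Implicit Types f g : l2 R I.

(** Sums over an arbitrary index type are read as limits along the finite
    subsets; for the nonnegative terms of [normsq] this is the supremum. *)
Definition normsq f : R :=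
  sup [set \sum_(x <- s) nsq (f x) | s in [set: {fset I}]].

Let sums_has_sup f :
  has_sup [set \sum_(x <- s) nsq (f x) | s in [set: {fset I}]].
Proof.
split; first by exists (\sum_(x <- fset0) nsq (f x)), fset0.
have /asboolP[M fM] := l2valP f.
by exists M => _ [s _ <-]; exact: fM.
Qed.

Lemma sum_le_normsq f (s : {fset I}) : \sum_(x <- s) nsq (f x) <= normsq f.
Proof. by apply: ub_le_sup; [case: (sums_has_sup f) | exists s]. Qed.

Lemma normsq_le f (M : R) :
  (forall s : {fset I}, \sum_(x <- s) nsq (f x) <= M) -> normsq f <= M.
Proof.
move=> fM; apply: ge_sup; first by case: (sums_has_sup f).
by move=> _ [s _ <-]; exact: fM.
Qed.

Lemma normsq_ge0 f : 0 <= normsq f.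
Proof. by have := sum_le_normsq f fset0; rewrite big_seq_fset0. Qed.

Lemma normsq_approx f (e : R) : 0 < e ->
  exists s : {fset I}, normsq f - e < \sum_(x <- s) nsq (f x).
Proof.
move=> e0; have [_ [s _ <-] ?] := sup_adherent e0 (sums_has_sup f).
by exists s.
Qed.

Lemma sum_fset_subset (F : I -> R) (s t : {fset I}) : (forall x, 0 <= F x) ->
  (s `<=` t)%fset -> \sum_(x <- s) F x <= \sum_(x <- t) F x.
Proof.
move=> F0 st; rewrite [leRHS](big_fsetID _ (mem s)) /=.
have -> : [fset x in t | x \in s]%fset = s.
  apply/fsetP => x; rewrite !inE /= andbC; case xs : (x \in s) => //=.
  exact: (fsubsetP st).
by rewrite lerDl sumr_ge0.
Qed.

Lemma nsq_le_normsq f x : nsq (f x) <= normsq f.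
Proof. by have := sum_le_normsq f [fset x]%fset; rewrite big_seq_fset1. Qed.

Lemma normsq_eq0 f : normsq f = 0 -> f = 0.
Proof.
move=> f0; apply: l2_eqP => x; apply: nsq_eq0; apply/eqP.
by rewrite eq_le nsq_ge0 -f0 nsq_le_normsq.
Qed.

Lemma cvg_normsq f :
  ((\sum_(x <- s) nsq (f x))%:C : R[i]^o) @[s --> totally] --> ((normsq f)%:C : R[i]^o).
Proof.
apply/cvgrPdist_lt => _ /posc_real[r r0 ->].
have [s0 s0P] := normsq_approx f r0.
exists s0 => // s /= s0s.
rewrite -raddfB /= normc_def /= expr0n addr0 sqrtr_sqr ltcR.
rewrite ger0_norm ?subr_ge0 ?sum_le_normsq //.
rewrite ltrBlDr -ltrBlDl (lt_le_trans s0P) //.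
exact: sum_fset_subset (fun x => nsq_ge0 (f x)) s0s.
Qed.

Lemma normsqD_weighted f g (e : R) : 0 < e ->
  normsq (f + g) <= (1 + e) * normsq f + (1 + e^-1) * normsq g.
Proof.
move=> e0; apply: normsq_le => s.
apply: (@le_trans _ _ (\sum_(x <- s) ((1 + e) * nsq (f x) + (1 + e^-1) * nsq (g x)))).
  by apply: ler_sum => x _; exact: nsqD_weighted.
rewrite big_split /= -!mulr_sumr.
by rewrite lerD // ler_wpM2l ?sum_le_normsq // addr_ge0 ?invr_ge0 ?(ltW e0).
Qed.

Definition l2norm f : R := Num.sqrt (normsq f).

(** The weight that minimises the bound of [normsqD_weighted] is the quotient of
    the two norms. *)
Lemma l2norm_triangle f g : l2norm (f + g) <= l2norm f + l2norm g.
Proof.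
have [->|f0] := eqVneq f 0; first by rewrite add0r lerDr sqrtr_ge0.
have [->|g0] := eqVneq g 0; first by rewrite addr0 lerDl sqrtr_ge0.
have pos h : h != 0 -> 0 < l2norm h.
  move=> h0; rewrite sqrtr_gt0 lt_def normsq_ge0 andbT.
  by apply: contraNneq h0 => /normsq_eq0 ->.
have := pos _ f0; have := pos _ g0; set a := l2norm f; set b := l2norm g => b0 a0.
have a2 : normsq f = a ^+ 2 by rewrite sqr_sqrtr ?normsq_ge0.
have b2 : normsq g = b ^+ 2 by rewrite sqr_sqrtr ?normsq_ge0.
apply: (@le_trans _ _ (Num.sqrt ((a + b) ^+ 2))); last first.
  by rewrite sqrtr_sqr ger0_norm // addr_ge0 ?ltW.
apply: ler_wsqrtr.
have := @normsqD_weighted f g (b / a) (divr_gt0 b0 a0).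
suff <- : (1 + b / a) * normsq f + (1 + (b / a)^-1) * normsq g = (a + b) ^+ 2 by [].
by rewrite a2 b2; field; rewrite !gt_eqF.
Qed.

End NormSquared.

Section InnerProduct.
Variables (R : realType) (I : choiceType).
Implicit Types f g h : l2 R I.

Let psum (F : I -> R[i]) (s : {fset I}) : R[i]^o := \sum_(x <- s) F x.

Definition l2inner f g : R[i] :=
  lim (psum (fun x => f x * (g x)^*) @ totally).

Let cvg_sq f : psum (fun x => f x * (f x)^*) @ totally --> ((normsq f)%:C : R[i]^o).
Proof.
apply: cvg_trans (@cvg_normsq _ _ f); apply: near_eq_cvg; apply: nearW => s /=.
by rewrite rmorph_sum /=; apply: eq_bigr => x _; rewrite nsqE.
Qed.

(** Polarization turns convergence of the sums of squares, which are monotone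
    and bounded, into convergence of the sums of products. *)
Let cvg_polar f g :
  psum (fun x => f x * (g x)^*) @ totally -->
  4^-1 *: ((normsq (f + g))%:C - (normsq (f - g))%:C
    + 'i *: (normsq (f + 'i *: g))%:C - 'i *: (normsq (f - 'i *: g))%:C : R[i]^o).
Proof.
have -> : psum (fun x => f x * (g x)^*) =
    4^-1 \*: (psum (fun x => (f + g : l2 R I) x * ((f + g : l2 R I) x)^*)
      \- psum (fun x => (f - g : l2 R I) x * ((f - g : l2 R I) x)^*)
      \+ 'i \*: psum (fun x => (f + 'i *: g : l2 R I) x * ((f + 'i *: g : l2 R I) x)^*)
      \- 'i \*: psum (fun x =>
          (f - 'i *: g : l2 R I) x * ((f - 'i *: g : l2 R I) x)^*)); last first.
  apply: cvgZl_tmp; apply: cvgB; last by apply: cvgZl_tmp; exact: cvg_sq.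
  apply: cvgD; last by apply: cvgZl_tmp; exact: cvg_sq.
  by apply: cvgB; exact: cvg_sq.
apply/funext => s.
rewrite /psum /= !scaler_sumr -!sumrB -big_split -sumrB scaler_sumr /=.
apply: eq_bigr => x _.
rewrite !(l2D, l2N, l2Z) !(rmorphD, rmorphN, rmorphM, rmorphB) /= conjCi.
rewrite /GRing.scale /=.
have i2 : 'i * 'i = -1 :> R[i] by rewrite -expr2 sqrCi.
set a := f x; set b := g x; set a' := a^*; set b' := b^*.
apply: (@mulfI _ 4); first by rewrite pnatr_eq0.
rewrite mulVKf ?pnatr_eq0 //.
transitivity (2 * (a * b' + b * a') - 2 * ('i * 'i * (a * b'))
  + 2 * ('i * 'i * (b * a'))); last by ring.
by rewrite i2; ring.
Qed.

Lemma inner_cvg f g : psum (fun x => f x * (g x)^*) @ totally --> (l2inner f g : R[i]^o).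
Proof. by apply/cvg_ex; eexists; exact: cvg_polar. Qed.

Lemma inner_unique f g (l : R[i]) :
  psum (fun x => f x * (g x)^*) @ totally --> (l : R[i]^o) -> l2inner f g = l.
Proof. exact: cvg_lim. Qed.

Lemma l2inner_normsq f : l2inner f f = (normsq f)%:C.
Proof. exact/inner_unique/cvg_sq. Qed.

Lemma l2inner_polar f g : l2inner f g =
  4^-1 * ((normsq (f + g))%:C - (normsq (f - g))%:C
    + 'i * (normsq (f + 'i *: g))%:C - 'i * (normsq (f - 'i *: g))%:C).
Proof. exact/inner_unique/cvg_polar. Qed.

(** Allows one to insert a diagonal projection on one side of an inner product
    when the other side is already fixed by it. *)
Lemma l2inner_ext f g f' g' :
  (forall x, f x * (g x)^* = f' x * (g' x)^*) -> l2inner f g = l2inner f' g'.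
Proof.
move=> fg; apply: inner_unique; apply: cvg_trans (@inner_cvg f' g').
apply: near_eq_cvg; apply: nearW => s /=.
by apply: eq_bigr => x _; rewrite fg.
Qed.

Lemma l2inner_linearl g a f f' :
  l2inner (a *: f + f') g = a * l2inner f g + l2inner f' g.
Proof.
apply: inner_unique.
have -> : psum (fun x => (a *: f + f' : l2 R I) x * (g x)^*) =
    (a \*: psum (fun x => f x * (g x)^*)) \+ psum (fun x => f' x * (g x)^*).
  apply/funext => s; rewrite /psum /= scaler_sumr -big_split /=; apply: eq_bigr => x _.
  by rewrite l2D l2Z mulrDl -mulrA.
by apply: cvgD; [apply: cvgZl_tmp|]; exact: inner_cvg.
Qed.

Lemma l2inner_herm f g : l2inner f g = (l2inner g f)^*.
Proof.
apply: inner_unique.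
apply/cvgrPdist_lt => e e0.
have /cvgrPdist_lt/(_ e e0) := @inner_cvg g f.
apply: filterS => s; congr (_ < _).
rewrite -[LHS]norm_conjC; congr (`|_|).
rewrite rmorphB /=; congr (_ - _).
rewrite /psum rmorph_sum; apply: eq_bigr => x _.
by rewrite rmorphM /= conjCK mulrC.
Qed.

End InnerProduct.

Section Hilbert.
Variables (R : realType) (I : choiceType).
Implicit Types f g h : l2 R I.

Let l2inner_bilinear : bilinear_for
  (GRing.Scale.Law.clone _ _ *%R _) (GRing.Scale.Law.clone _ _ (Num.conj \; *%R) _)
  (@l2inner R I).
Proof.
split=> [g a f f'|f a g g'] /=; first exact: l2inner_linearl.
rewrite l2inner_herm l2inner_linearl rmorphD rmorphM /=.
by rewrite -!(l2inner_herm f).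
Qed.

HB.instance Definition _ :=
  bilinear_isBilinear.Build R[i] (l2 R I) (l2 R I) R[i]
    (GRing.Scale.Law.clone _ _ *%R _)
    (GRing.Scale.Law.clone _ _ (Num.conj \; *%R) _) (@l2inner R I)
    l2inner_bilinear.

Let l2inner_hermitian f g :
  l2inner f g = (-1) ^+ false * Num.conj (l2inner g f).
Proof. by rewrite expr0 mul1r; exact: l2inner_herm. Qed.

HB.instance Definition _ := isHermitianSesquilinear.Build R[i] (l2 R I) false
  Num.conj (@l2inner R I) l2inner_hermitian.

Let l2inner_gt0 f : f != 0 -> 0 < l2inner f f.
Proof.
move=> f0; rewrite l2inner_normsq ltcR lt_def normsq_ge0 andbT.
by apply: contraNneq f0 => /normsq_eq0 ->.
Qed.

HB.instance Definition _ :=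
  isDotProduct.Build R[i] (l2 R I) (@l2inner R I) l2inner_gt0.

Let norm_triangle f g : (l2norm (f + g))%:C <= (l2norm f)%:C + (l2norm g)%:C.
Proof. by rewrite -raddfD lecR; exact: l2norm_triangle. Qed.

Lemma normsqZ a f : normsq (a *: f) = nsq a * normsq f.
Proof.
apply: complexI; rewrite -l2inner_normsq (dnormZ (@l2inner R I)).
by rewrite rmorphM /= nsqE normCK l2inner_normsq.
Qed.

Let norm_scale a f : (l2norm (a *: f))%:C = `|a| * (l2norm f)%:C.
Proof.
by rewrite /l2norm normsqZ sqrtrM ?nsq_ge0 // rmorphM /= normc_def.
Qed.

Let norm_eq0 f : (l2norm f)%:C = 0 -> f = 0.
Proof.
move=> [/eqP]; rewrite sqrtr_eq0 => f0; apply: normsq_eq0; apply/eqP.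
by rewrite eq_le f0 normsq_ge0.
Qed.

HB.instance Definition _ := Lmodule_isNormed.Build R[i] (l2 R I)
  norm_triangle norm_scale norm_eq0.

Lemma l2_normE f : `|f| = (l2norm f)%:C. Proof. by []. Qed.

Lemma l2norm_sqr f : l2norm f ^+ 2 = normsq f.
Proof. by rewrite sqr_sqrtr ?normsq_ge0. Qed.

Lemma l2norm_leP f (e : R) : 0 <= e -> (l2norm f <= e) = (normsq f <= e ^+ 2).
Proof.
by move=> e0; rewrite -l2norm_sqr ler_sqr // nnegrE ?sqrtr_ge0.
Qed.

Section Complete.
Variable F : set_system (l2 R I).
Hypotheses (FF : ProperFilter F) (Fc : cauchy F).

(** Completeness: a Cauchy filter converges coordinatewise, because each
    coordinate is bounded by the norm. *)
Let close (e : R) : 0 < e -> exists f0, \forall f \near F, l2norm (f0 - f) < e.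
Proof.
move=> e0; have /cauchyP/(_ e%:C) := Fc.
case; first by rewrite ltcR.
move=> f0 Ff0; exists f0; apply: filterS Ff0 => f /=.
by rewrite -ball_normE /ball_ /= l2_normE ltcR.
Qed.

(* Applied to the real and to the imaginary part. *)
Let cvg_part (p : R[i] -> R) x :
  (forall a b, p (a - b) = p a - p b) -> (forall a, p a ^+ 2 <= nsq a) ->
  cvg (p (f x) @[f --> F]).
Proof.
move=> pB pn; apply: cauchy_cvg.
apply/cauchyP => e e0.
have [f0 Ff0] := close e0; exists (p (f0 x)).
apply: filterS Ff0 => f /= f0f.
rewrite -ball_normE /ball_ /= -pB.
apply: le_lt_trans f0f; rewrite -sqrtr_sqr; apply: ler_wsqrtr.
by apply: le_trans (pn _) _; exact: (nsq_le_normsq (f0 - f)).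
Qed.

Let g x : R[i] :=
  lim (complex.Re (f x) @[f --> F]) +i* lim (complex.Im (f x) @[f --> F]).

Let cvg_nsq (c : R[i]) x : nsq (c - f x) @[f --> F] --> nsq (c - g x).
Proof.
have cre : complex.Re (f x) @[f --> F] --> complex.Re (g x).
  apply: cvg_part => [[a1 a2] [b1 b2]|[a1 a2]] //=.
  by rewrite /nsq /= lerDl sqr_ge0.
have cim : complex.Im (f x) @[f --> F] --> complex.Im (g x).
  apply: cvg_part => [[a1 a2] [b1 b2]|[a1 a2]] //=.
  by rewrite /nsq /= lerDr sqr_ge0.
have E z : nsq (c - z) = (complex.Re c - complex.Re z) * (complex.Re c - complex.Re z)
    + (complex.Im c - complex.Im z) * (complex.Im c - complex.Im z).
  by case: c z => [? ?] [? ?]; rewrite /nsq /= !expr2.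
rewrite E; under eq_fun do rewrite E.
by apply: cvgD; apply: cvgM; apply: cvgB => //; exact: cvg_cst.
Qed.

(** Finite sums pass to the pointwise limit, so the pointwise limit is also the
    limit in norm. *)
Let sum_limit f0 (e : R) (s : {fset I}) : 0 <= e ->
  (\forall f \near F, l2norm (f0 - f) <= e) ->
  \sum_(x <- s) nsq (f0 x - g x) <= e ^+ 2.
Proof.
move=> e0 Ff0.
have : \sum_(x <- s) nsq (f0 x - f x) @[f --> F] -->
       \sum_(x <- s) nsq (f0 x - g x).
  elim: (enum_fset s) => [|x r IH].
    by rewrite big_nil; under eq_fun do rewrite big_nil; exact: cvg_cst.
  rewrite big_cons; under eq_fun do rewrite big_cons.
  by apply: cvgD => //; exact: cvg_nsq.
move=> /cvgr_to_le; apply; apply: filterS Ff0 => f.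
rewrite l2norm_leP //; apply: le_trans; exact: (sum_le_normsq (f0 - f)).
Qed.

Let g_summable : g \in @square_summable R I.
Proof.
have [f0 Ff0] := close ltr01.
have Ff0' : \forall f \near F, l2norm (f0 - f) <= 1.
  by apply: filterS Ff0 => f /ltW.
have : (fun x => f0 x - g x) \in @square_summable R I.
  by apply/asboolP; exists (1 ^+ 2) => s; exact: sum_limit.
move=> f0g; have -> : g = l2val f0 - (fun x => f0 x - g x).
  by apply/funext => x; rewrite !fctE opprB addrC subrK.
by rewrite rpredB // l2valP.
Qed.

Lemma l2_cauchy_cvg : cvg F.
Proof.
apply/cvg_ex; exists (L2 g_summable).
apply/cvgrPdist_le => _ /posc_real[r r0 ->].
have r2 : 0 < r / 2 by rewrite divr_gt0.
have [f0 Ff0] := close r2.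
have Ff0' : \forall f \near F, l2norm (f0 - f) <= r / 2.
  by apply: filterS Ff0 => f /ltW.
apply: filterS Ff0' => f f0f /=.
rewrite l2_normE lecR.
have -> : L2 g_summable - f = (f0 - f) + (-1) *: (f0 - L2 g_summable).
  by rewrite scaleN1r opprB [RHS]addrC addrA subrK.
apply: le_trans (l2norm_triangle _ _) _.
rewrite [leRHS]splitr lerD //.
rewrite l2norm_leP ?(ltW r2) // normsqZ nsqN.
have -> : nsq (1 : R[i]) = 1 by rewrite /nsq /= expr1n expr0n addr0.
rewrite mul1r; apply: normsq_le => s; apply: sum_limit; rewrite ?(ltW r2) //.
by apply: filterS Ff0 => f' /ltW.
Qed.

End Complete.

HB.instance Definition _ := Uniform_isComplete.Build (l2 R I) l2_cauchy_cvg.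

Let l2_inner_norm f : `|f| ^+ 2 = l2inner f f.
Proof. by rewrite l2_normE -rmorphXn /= l2norm_sqr l2inner_normsq. Qed.

Definition l2_hilbert : hilbertType R := HilbertType l2_inner_norm.

End Hilbert.

(** * Dimensions and adjoints *)

Section Dimensions.
Variables (K : fieldType) (V : lmodType K).
Implicit Types W : set V.

Lemma lin_span_sub (S T : set V) :
  (forall s, S s -> lin_span T s) -> lin_span S `<=` lin_span T.
Proof.
move=> ST _ [d [c [s [Ss ->]]]].
elim/big_ind: _ => [|u v [d1 [c1 [s1 [T1 ->]]]] [d2 [c2 [s2 [T2 ->]]]]|i _].
- exists 0%N, (fun=> 0), (fun=> 0); split; first by case.
  by rewrite big_ord0.
- exists (d1 + d2)%N,
    (fun i => match fintype.split i with inl j => c1 j | inr j => c2 j end),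
    (fun i => match fintype.split i with inl j => s1 j | inr j => s2 j end).
  split; first by move=> i; case: fintype.split.
  rewrite big_split_ord /=; congr (_ + _); apply: eq_bigr => i _.
    by have := unsplitK (inl i : 'I_d1 + 'I_d2) => /= ->.
  by have := unsplitK (inr i : 'I_d1 + 'I_d2) => /= ->.
- have [d1 [c1 [s1 [T1 ->]]]] := ST _ (Ss i).
  exists d1, (fun j => c i * c1 j), s1; split => //.
  by rewrite scaler_sumr; apply: eq_bigr => j _; rewrite scalerA.
Qed.

Lemma lin_span_id (S : set V) : S `<=` lin_span S.
Proof.
move=> v Sv; exists 1%N, (fun=> 1), (fun=> v); split => //.
by rewrite big_ord1 scale1r.
Qed.

Lemma lin_span_range d (b : 'I_d -> V) v : lin_span (range b) v ->
  exists c : 'I_d -> K, v = \sum_(i < d) c i *: b i.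
Proof.
move=> [e [c [s [bs ->]]]].
elim/big_ind: _ => [|u w [c1 ->] [c2 ->]|i _].
- by exists (fun=> 0); rewrite big1 // => i _; rewrite scale0r.
- exists (fun i => c1 i + c2 i); rewrite -big_split; apply: eq_bigr => i _.
  by rewrite scalerDl.
- have [j _ <-] := bs i; exists (fun l => (l == j)%:R * c i).
  rewrite (bigD1 j) //= eqxx mul1r big1 ?addr0 // => l /negbTE ->.
  by rewrite mul0r scale0r.
Qed.

Let has_dim_le W d e : has_dim W d -> has_dim W e -> (d <= e)%N.
Proof.
move=> [b [bI bW]] [b' [_ b'W]].
have inb' i : exists c : 'I_e -> K, b i = \sum_(j < e) c j *: b' j.
  by apply: lin_span_range; rewrite b'W -bW; apply: lin_span_id; exists i.
have inb j : exists c : 'I_d -> K, b' j = \sum_(i < d) c i *: b i.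
  by apply: lin_span_range; rewrite bW -b'W; apply: lin_span_id; exists j.
have [A AP] := boolp.choice inb'; have [B BP] := boolp.choice inb.
pose MA := \matrix_(i, j) A i j; pose MB := \matrix_(j, i) B j i.
suff /mulmx1_min : MA *m MB = 1%:M by [].
apply/matrixP => i l; rewrite !mxE; apply/eqP; rewrite -subr_eq0; apply/eqP.
apply: (bI (fun l => \sum_j MA i j * MB j l - (i == l)%:R)).
under eq_bigr do rewrite scalerBl scaler_suml.
rewrite sumrB exchange_big /=.
rewrite [X in _ - X](bigD1 i) //= eqxx scale1r [X in _ - (_ + X)]big1; last first.
  by move=> l' /negbTE; rewrite eq_sym => ->; rewrite scale0r.
rewrite addr0 [b i]AP -sumrB big1 // => j _.
rewrite BP scaler_sumr -sumrB big1 // => l' _.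
by rewrite !mxE scalerA subrr.
Qed.

Lemma lin_dimE W d : has_dim W d -> lin_dim W = d.
Proof.
move=> Wd; apply: xget_unique => // e We; apply/eqP.
by rewrite eqn_leq (has_dim_le We Wd) (has_dim_le Wd We).
Qed.

End Dimensions.

Section Adjoint.
Variables (R : realType) (H : hilbertType R).

Lemma adjoint_unique (A B : H -> H) :
  (forall x y, inner H (A x) y = inner H x (B y)) -> adjoint A = B.
Proof.
move=> AB; apply/funext => y; apply: xget_unique => [x|z zP]; first exact: AB.
have zB x : inner H x (z - B y) = 0.
  rewrite linearBr; apply/eqP; rewrite subr_eq0; apply/eqP.
  exact: etrans (esym (zP x)) (AB x y).
have := zB (z - B y); rewrite -inner_norm => /eqP.
by rewrite expf_eq0 /= normr_eq0 subr_eq0 => /eqP.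
Qed.

End Adjoint.

(** * Operators that permute basis vectors *)

(** A partial bijection of the index set, stored with its inverse so that the
    adjoint of the operator that it induces is again of this form. *)
Record pbij (I : Type) := PBij {
  pfwd : I -> option I;
  pbwd : I -> option I;
  pbijP : forall x y, pfwd x = Some y <-> pbwd y = Some x }.

Definition pinv I (p : pbij I) : pbij I :=
  PBij (fun x y => iff_sym (pbijP p y x)).

Definition prestrict I (d : pred I) : pbij I.
Proof.
by exists (fun x => if d x then Some x else None)
          (fun x => if d x then Some x else None) => x y;
  case dx: (d x); case dy: (d y); split=> // -[e]; move: dx dy; rewrite e => ->.
Defined.

Section Shift.
Variables (R : realType) (I : choiceType).
Implicit Types (p : pbij I) (f g : l2 R I).

Lemma sum_uniq_le_normsq f (r : seq I) : uniq r ->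
  \sum_(x <- r) nsq (f x) <= normsq f.
Proof.
move=> ur; apply: le_trans (sum_le_normsq f [fset x in r]%fset).
rewrite (perm_big (enum_fset [fset x in r]%fset)) //=.
by apply: uniq_perm => // x; rewrite !inE.
Qed.

Let sum_pshift_le p f (s : {fset I}) :
  \sum_(x <- s) nsq (oapp f 0 (pbwd p x)) <= normsq f.
Proof.
apply: le_trans (@sum_uniq_le_normsq f (pmap (pbwd p) s) _); last first.
  apply: (@pmap_uniq _ _ _ (fun y => odflt y (pfwd p y))) => //.
  by move=> x /=; case E: (pbwd p x) => [y|] //=; move/pbijP: E => ->.
elim: (enum_fset s) => [|x r IH] /=; first by rewrite !big_nil.
rewrite big_cons; case: (pbwd p x) => [y|] /=; first by rewrite big_cons lerD2l.
by rewrite nsq0 add0r.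
Qed.

Let pshift_summable p f :
  (fun x => oapp f 0 (pbwd p x)) \in @square_summable R I.
Proof. by apply/asboolP; exists (normsq f) => s; exact: sum_pshift_le. Qed.

(** The operator that sends the basis vector of [y] to that of [pfwd p y], or to
    zero if [p] is undefined at [y]. *)
Definition pshift p f : l2 R I := L2 (pshift_summable p f).

Lemma pshiftE p f x : pshift p f x = oapp f 0 (pbwd p x). Proof. by []. Qed.

Lemma normsq_pshift p f : normsq (pshift p f) <= normsq f.
Proof. by apply: normsq_le => s; exact: sum_pshift_le. Qed.

Let pshift_linear p : linear (pshift p).
Proof.
move=> a f g; apply: l2_eqP => x; rewrite l2D l2Z !pshiftE.
by case: (pbwd p x) => [y|] //=; rewrite mulr0 addr0.
Qed.

HB.instance Definition _ p := GRing.isLinear.Build R[i] (l2 R I) (l2 R I) _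
  (pshift p) (pshift_linear p).

Let pshift_bounded p : exists M : R[i], forall f : l2_hilbert R I,
  `|pshift p f| <= M * `|f|.
Proof.
exists 1 => f; rewrite mul1r !l2_normE lecR l2norm_leP ?sqrtr_ge0 //.
by rewrite l2norm_sqr normsq_pshift.
Qed.

Definition pshift_op p : boundedOp (l2_hilbert R I) :=
  @BoundedOp R (l2_hilbert R I) (pshift p) (pshift_bounded p).

Let pshiftK p f : pshift p (pshift (pinv p) (pshift p f)) = pshift p f.
Proof.
apply: l2_eqP => x; rewrite !pshiftE; case E: (pbwd p x) => [y|] //=.
by rewrite pshiftE /=; move/pbijP: (E) => -> /=; rewrite pshiftE /= E.
Qed.

Let pshift_isometry p f :
  normsq (pshift (pinv p) (pshift p f)) = normsq (pshift p f).
Proof.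
apply/eqP; rewrite eq_le normsq_pshift /=.
by rewrite -{1}pshiftK normsq_pshift.
Qed.

Let inner_pshift p f g :
  l2inner (pshift (pinv p) (pshift p f)) (pshift (pinv p) (pshift p g)) =
  l2inner (pshift p f) (pshift p g).
Proof. by rewrite !l2inner_polar -!linearZ -!linearB -!linearD !pshift_isometry. Qed.

(** [pshift p] maps the vectors supported on the domain of [p] isometrically onto
    those supported on its range, with inverse [pshift (pinv p)]; polarization
    turns isometry into invariance of the inner product. *)
Lemma adjoint_pshift p :
  adjoint (pshift p : l2_hilbert R I -> l2_hilbert R I) = pshift (pinv p).
Proof.
apply: adjoint_unique => f g /=.
have -> : l2inner (pshift p f) g = l2inner (pshift p f) (pshift p (pshift (pinv p) g)).
  apply: l2inner_ext => x; rewrite !pshiftE.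
  case E: (pbwd p x) => [y|] /=; last by rewrite !mul0r.
  by rewrite pshiftE /=; move/pbijP: E => ->.
have -> : l2inner f (pshift (pinv p) g) =
    l2inner (pshift (pinv p) (pshift p f)) (pshift (pinv p) g).
  apply: l2inner_ext => x; rewrite !pshiftE /=.
  case E: (pfwd p x) => [y|] /=; last by rewrite !conjC0 !mulr0.
  by rewrite pshiftE; move/pbijP: E => ->.
rewrite -inner_pshift; congr l2inner; apply: l2_eqP => x.
rewrite !pshiftE /=; case E: (pfwd p x) => [y|] //=.
by rewrite pshiftE /=; move/pbijP: (E) => -> /=; rewrite pshiftE /= E.
Qed.

Definition l2_proj (d : pred I) : l2 R I -> l2 R I := pshift (prestrict d).

Lemma l2_projE d f x : l2_proj d f x = if d x then f x else 0.
Proof. by rewrite /l2_proj pshiftE /=; case: (d x). Qed.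

Lemma eq_proj d d' : d =1 d' -> l2_proj d = l2_proj d'.
Proof. by move=> dd'; apply/funext => f; apply: l2_eqP => x; rewrite !l2_projE dd'. Qed.

Lemma proj_predT : l2_proj predT = id.
Proof. by apply/funext => f; apply: l2_eqP => x; rewrite l2_projE. Qed.

Lemma proj_positive d : positive_op (l2_proj d : l2_hilbert R I -> l2_hilbert R I).
Proof.
move=> f /=; have -> : l2inner (l2_proj d f) f = l2inner (l2_proj d f) (l2_proj d f).
  by apply: l2inner_ext => x; rewrite l2_projE; case: (d x); rewrite ?mul0r.
by rewrite l2inner_normsq lecR normsq_ge0.
Qed.

Lemma range_proj d : range (l2_proj d) = [set f | forall x, ~~ d x -> f x = 0].
Proof.
apply/seteqP; split=> [_ [f _ <-] x dx|f fd].
  by rewrite l2_projE (negbTE dx).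
exists f => //; apply: l2_eqP => x; rewrite l2_projE.
by case: ifPn => // /fd.
Qed.

(** All but a small part of the squared norm is carried by a finite set of
    indices, which is eventually excluded. *)
Lemma proj_cvg0 (d : nat -> pred I) :
  (forall x, exists N, forall l, (N <= l)%N -> ~~ d l x) ->
  forall f : l2_hilbert R I, l2_proj (d l) f @[l --> \oo] --> (0 : l2_hilbert R I).
Proof.
move=> dP f; apply/cvgrPdist_le => _ /posc_real[r r0 ->].
have [s sP] := normsq_approx f (exprn_gt0 2 r0).
have [N NP] : exists N, forall l x, (N <= l)%N -> x \in enum_fset s -> ~~ d l x.
  elim: (enum_fset s) => [|y t [N NP]]; first by exists 0%N.
  have [M MP] := dP y; exists (maxn M N) => l x; rewrite geq_max => /andP[Ml Nl].
  by rewrite inE => /predU1P[->|yt]; [exact: MP|exact: NP yt].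
exists N => // l /= Nl; rewrite sub0r normrN l2_normE lecR l2norm_leP ?(ltW r0) //.
apply: normsq_le => t.
rewrite (big_fsetID _ (mem s)) /= [X in X + _]big_seq big1 ?add0r; last first.
  by move=> x; rewrite !inE => /andP[_ xs]; rewrite l2_projE (negbTE (NP _ _ Nl xs)) nsq0.
apply: (@le_trans _ _ (\sum_(x <- [fset x in t | x \notin s]%fset) nsq (f x))).
  by apply: ler_sum => x _; rewrite l2_projE; case: ifP; rewrite ?nsq0 ?nsq_ge0.
rewrite -(lerD2l (\sum_(x <- s) nsq (f x))).
apply: (@le_trans _ _ (normsq f)); last by rewrite -lerBlDr ltW.
rewrite -big_cat; apply: sum_uniq_le_normsq.
rewrite cat_uniq !fset_uniq andbT /=; apply/hasPn => x.
by rewrite !inE => /andP[].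
Qed.

End Shift.

Section Basis.
Variables (R : realType) (I : choiceType).
Implicit Types (f g : l2 R I).

Let delta_summable x :
  (fun y => (y == x)%:R) \in @square_summable R I.
Proof.
apply/asboolP; exists 1 => s.
have nsq1 : nsq (1 : R[i]) = 1 by rewrite /nsq /= expr1n expr0n addr0.
have [xs|xs] := boolP (x \in s).
  rewrite (big_fsetD1 x) //= eqxx nsq1 big_seq big1 ?addr0 // => y.
  by rewrite !inE => /andP[/negbTE -> _]; rewrite nsq0.
rewrite big_seq big1 // => y ys.
by case: eqP ys xs => [-> ->|_ _ _] //; rewrite nsq0.
Qed.

Definition l2_delta x : l2 R I := L2 (delta_summable x).

Lemma l2_deltaE x y : l2_delta x y = (y == x)%:R. Proof. by []. Qed.

Let deltas_tnth (r : seq I) (c : 'I_(size r) -> R[i]) i : uniq r ->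
  (\sum_j c j *: l2_delta (tnth (in_tuple r) j) : l2 R I) (tnth (in_tuple r) i) = c i.
Proof.
move=> ur; rewrite l2_sum (bigD1 i) //= l2Z l2_deltaE eqxx mulr1.
rewrite big1 ?addr0 // => j ji; rewrite l2Z l2_deltaE.
by rewrite (inj_eq (elimT (tuple_uniqP (in_tuple r)) ur)) eq_sym (negbTE ji) mulr0.
Qed.

Let deltas_out (r : seq I) (c : 'I_(size r) -> R[i]) x : x \notin r ->
  (\sum_j c j *: l2_delta (tnth (in_tuple r) j) : l2 R I) x = 0.
Proof.
move=> xr; rewrite l2_sum big1 // => j _; rewrite l2Z l2_deltaE.
by case: eqP xr => [->|_ _]; rewrite ?mem_tnth ?mulr0.
Qed.

Lemma support_expansion (r : seq I) f : uniq r ->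
  (forall x, x \notin r -> f x = 0) ->
  f = \sum_(i < size r) f (tnth (in_tuple r) i) *: l2_delta (tnth (in_tuple r) i).
Proof.
move=> ur fr; apply: l2_eqP => x.
have [xr|xr] := boolP (x \in r); last by rewrite fr // deltas_out.
have [i ->] : exists i, x = tnth (in_tuple r) i by exact/tnthP.
by rewrite deltas_tnth.
Qed.

Lemma has_dim_support (r : seq I) : uniq r ->
  has_dim [set f : l2 R I | forall x, x \notin r -> f x = 0] (size r).
Proof.
move=> ur; exists (fun i => l2_delta (tnth (in_tuple r) i)); split=> [c c0 i|].
  by rewrite -(deltas_tnth c i ur) c0.
apply/seteqP; split=> [f /lin_span_range[c ->] x /= xr|f fr].
  exact: deltas_out.
exists (size r), (fun i => f (tnth (in_tuple r) i)),
  (fun i => l2_delta (tnth (in_tuple r) i)); split; first by move=> i; exists i.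
exact: support_expansion.
Qed.

End Basis.

(** * The compressed creation operators *)

Section Words.
Variables (k m : nat) (n : 'I_k -> nat).

(** The basis labels of [m] copies of the tensor product of the full Fock spaces
    of the [k] coordinates. *)
Definition label : Type := ('I_m * {dffun forall i : 'I_k, seq 'I_(n i)})%type.
HB.instance Definition _ := Choice.on label.

Implicit Types (u v : label) (i : 'I_k).

Definition set_word u i (w : seq 'I_(n i)) : label :=
  (u.1, [ffun j => @dfwith _ (fun i => seq 'I_(n i)) u.2 i w j]).
Definition pop i u : label := set_word u (behead (u.2 i)).
Definition push i (j : 'I_(n i)) u : label := set_word u (j :: u.2 i).
Definition vacuum (c : 'I_m) : label := (c, [ffun=> [::]]).

Lemma label_eqP u v : u.1 = v.1 -> (forall i, u.2 i = v.2 i) -> u = v.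
Proof. by case: u v => [c a] [d b] /= -> ab; congr pair; apply/ffunP. Qed.

Lemma set_word_in u i (w : seq 'I_(n i)) : (set_word u w).2 i = w.
Proof. by rewrite ffunE dfwithin. Qed.

Lemma set_word_out u i (w : seq 'I_(n i)) j : i != j ->
  (set_word u w).2 j = u.2 j.
Proof. by move=> ij; rewrite ffunE dfwithout. Qed.

Lemma set_word_id u i (w : seq 'I_(n i)) : u.2 i = w -> set_word u w = u.
Proof.
move=> uw; apply: label_eqP => // j.
by have [<-|ij] := eqVneq i j; rewrite ?set_word_in ?uw ?set_word_out.
Qed.

Lemma set_word_twice u i (w w' : seq 'I_(n i)) :
  set_word (set_word u w) w' = set_word u w'.
Proof.
apply: label_eqP => // j.
by have [<-|ij] := eqVneq i j; rewrite ?set_word_in ?set_word_out.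
Qed.

Lemma set_wordC u i i' (w : seq 'I_(n i)) (w' : seq 'I_(n i')) : i != i' ->
  set_word (set_word u w) w' = set_word (set_word u w') w.
Proof.
move=> ii'; apply: label_eqP => // j.
have [ij|ij] := eqVneq i j; have [i'j|i'j] := eqVneq i' j.
- by case/eqP: ii'; rewrite ij i'j.
- by subst j; rewrite set_word_out ?set_word_in.
- by subst j; rewrite set_word_in set_word_out ?set_word_in.
- by rewrite !set_word_out.
Qed.

Lemma popC u i i' : i != i' -> pop i (pop i' u) = pop i' (pop i u).
Proof.
by move=> ii'; rewrite /pop !set_word_out // 1?eq_sym // set_wordC // eq_sym.
Qed.

Lemma pushK i (j : 'I_(n i)) u : pop i (push j u) = u.
Proof. by rewrite /pop /push set_word_in /= set_word_twice set_word_id. Qed.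

Lemma push_pop i (j : 'I_(n i)) u :
  (push j (pop i u) == u) = (ohead (u.2 i) == Some j).
Proof.
apply/eqP/eqP => [<-|uj]; first by rewrite set_word_in.
rewrite /push /pop set_word_in set_word_twice set_word_id //.
by case: (u.2 i) uj => //= a w [->].
Qed.

Lemma eq_push i (j : 'I_(n i)) u v :
  (u == push j v) = (ohead (u.2 i) == Some j) && (pop i u == v).
Proof.
apply/eqP/andP => [->|[/eqP uj /eqP <-]].
  by rewrite pushK set_word_in.
by apply/esym/eqP; rewrite push_pop uj.
Qed.

End Words.

Section Model.
Variables (R : realType) (k m : nat) (n : 'I_k -> nat).
Variable P : pred (label m n).
Hypothesis P_pop : forall i u, P u -> P (pop i u).

Let I : choiceType := {u : label m n | P u}.
Let H := l2_hilbert R I.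
Implicit Types (f g : l2 R I) (x y : I) (u v : label m n).

Let creation_subproof i (j : 'I_(n i)) (y x : I) :
  insub (push j (val y)) = Some x <->
  (if ohead ((val x).2 i) == Some j then insub (pop i (val x)) else None) = Some y.
Proof.
have insubE u z : (insub u : option I) = Some z <-> val z = u.
  split=> [|<-]; last exact: valK.
  by case: insubP => //= z' _ <- [->].
rewrite insubE; case: ifPn => xj.
  rewrite insubE; split=> [e|->].
    by rewrite e pushK.
  by apply/esym/eqP; rewrite push_pop.
by split=> // e; move: xj; rewrite e set_word_in eqxx.
Qed.

(** The compression to [P] of the [j]-th left creation operator of the [i]-th
    Fock space. *)
Definition creation i (j : 'I_(n i)) : pbij I := PBij (creation_subproof j).

Definition model : opTuple H n := fun i j => pshift_op R (creation j).

(** The value at [u], read as zero outside [P]. *)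
Definition ext0 f u : R[i] := oapp f 0 (insub u).

Lemma ext0_val f x : ext0 f (val x) = f x.
Proof. by rewrite /ext0 valK. Qed.

Lemma modelE i (j : 'I_(n i)) f x :
  model j f x = if ohead ((val x).2 i) == Some j then ext0 f (pop i (val x)) else 0.
Proof. by rewrite /model /= pshiftE /=; case: ifP. Qed.

Lemma model_adjointE i (j : 'I_(n i)) f x :
  (adjoint (model j) f : l2 R I) x = ext0 f (push j (val x)).
Proof. by rewrite /model /= adjoint_pshift pshiftE. Qed.

Lemma model_cross_commuting : cross_commuting model.
Proof.
move=> s t st a b f; have ts : t != s by rewrite eq_sym.
apply: l2_eqP => x; rewrite !modelE.
have pop_sub i : {y : I | val y = pop i (val x)}.
  by exists (Sub (pop i (val x)) (P_pop i (valP x))).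
have [ys ysE] := pop_sub s; have [yt ytE] := pop_sub t.
rewrite -ysE -ytE !ext0_val !modelE ysE ytE /= popC //.
rewrite /pop !set_word_out //.
by case: ifP; case: ifP.
Qed.

Definition projl (d : pred (label m n)) : l2 R I -> l2 R I :=
  @l2_proj R I (fun x => d (val x)).

Lemma eq_projl d d' : d =1 d' -> projl d = projl d'.
Proof. by move=> dd'; apply: eq_proj => x; exact: dd'. Qed.

(** The ranges of the creation operators of one coordinate are orthogonal and
    span the labels whose word in this coordinate is not empty. *)
Lemma Phi_projl i d :
  Phi model i (projl d) = projl (fun u => (u.2 i != [::]) && d (pop i u)).
Proof.
apply/funext => f; apply: l2_eqP => x; rewrite /Phi l2_sum l2_projE.
under eq_bigr do rewrite modelE.
case E: ((val x).2 i) => [|a w] /=; first by rewrite big1.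
rewrite (bigD1 a) //= eqxx big1 ?addr0; last first.
  by move=> j /negbTE ja; rewrite (_ : _ == _ = false) // [LHS]eq_sym; exact: ja.
have [y yE] : {y : I | val y = pop i (val x)}.
  by exists (Sub (pop i (val x)) (P_pop i (valP x))).
rewrite -yE ext0_val l2_projE; case: ifP => // _.
rewrite model_adjointE yE.
have /eqP -> : push a (pop i (val x)) == val x by rewrite push_pop E.
exact: ext0_val.
Qed.

(** Each application of [Phi] removes the labels that are used up after one more
    letter, so every label is eventually excluded: this gives purity. *)
Lemma iter_Phi i p :
  iter p (Phi model i) id = projl (fun u => p <= size (u.2 i))%N.
Proof.
elim: p => [|p IH] /=; first by rewrite -proj_predT; apply: eq_proj => x.
rewrite IH Phi_projl; apply: eq_projl => u.
by rewrite /pop set_word_in; case: (u.2 i).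
Qed.

Lemma model_pure : pure model.
Proof.
move=> i f; under eq_fun do rewrite iter_Phi.
apply: proj_cvg0 => x; exists (size ((val x).2 i)).+1 => p.
by rewrite -ltnNge.
Qed.

(** [id - Phi i] multiplies by the indicator of an empty [i]-th word any
    diagonal projection that does not look at this word; the coordinates are
    therefore treated one after the other. *)
Lemma Delta_model (p : 'I_k -> bool) :
  Delta model p id = projl (fun u => [forall i, p i ==> (u.2 i == [::])]).
Proof.
have -> : id = projl predT :> (l2 R I -> l2 R I).
  by rewrite -proj_predT; exact: eq_proj.
rewrite /Delta.
suff E r : uniq r ->
    (\big[comp/id]_(i <- r) iter (p i) (fun Y : H -> H => Y \- Phi model i Y))
      (projl predT) = projl (fun u => all (fun i => p i ==> (u.2 i == [::])) r).
  rewrite E ?index_enum_uniq //; apply: eq_projl => u.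
  apply/allP/forallP => h i; last by [].
  by apply: h; rewrite mem_index_enum.
elim: r => [|i r IH] /=; first by rewrite big_nil.
move=> /andP[ir ur]; rewrite big_cons /= IH //.
case: (p i) => //=; rewrite Phi_projl.
apply/funext => f; apply: l2_eqP => x; rewrite /= l2D l2N !l2_projE.
set d := all _ r; have -> : all (fun j => p j ==> ((pop i (val x)).2 j == [::])) r = d.
  apply: eq_in_all => j jr; rewrite /pop set_word_out //.
  by apply: contraNneq ir => ->.
by case: eqP => _ //=; case: d; rewrite ?subr0 ?subrr.
Qed.

Lemma model_polyball : polyball model.
Proof.
split; first exact: model_cross_commuting.
by move=> p; rewrite Delta_model; exact: proj_positive.
Qed.

Lemma model_defect :
  defect model = projl (fun u => [forall i, u.2 i == [::]]).
Proof. exact: Delta_model. Qed.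

Lemma has_dim_labels (d : pred (label m n)) (s : seq (label m n)) : uniq s ->
  (forall u, (u \in s) = d u) ->
  has_dim [set f : l2 R I | forall x, ~~ d (val x) -> f x = 0] (count P s).
Proof.
move=> us sd; rewrite -(size_pmap_sub I).
have -> : [set f : l2 R I | forall x, ~~ d (val x) -> f x = 0] =
    [set f | forall x, x \notin pmap insub s -> f x = 0].
  by apply/seteqP; split=> f /= fd x; move: (fd x); rewrite mem_pmap_sub sd.
exact/has_dim_support/pmap_sub_uniq.
Qed.

Lemma has_dim_defect : (forall c, P (vacuum n c)) ->
  has_dim (range (defect model)) m.
Proof.
move=> Pv; rewrite model_defect range_proj.
pose s := [seq vacuum n c | c <- enum 'I_m].
have sm : count P s = m.
  by rewrite count_map (eq_count (a2 := predT)) ?count_predT ?size_enum_ord.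
rewrite -[X in has_dim _ X]sm.
apply: (@has_dim_labels (fun u => [forall i, u.2 i == [::]])).
  by rewrite map_inj_uniq ?enum_uniq // => c c' [].
move=> u; apply/mapP/forallP => [[c _ ->] i|u0]; first by rewrite ffunE.
exists u.1; first by rewrite mem_enum.
by apply: label_eqP => // i; rewrite ffunE; exact/eqP.
Qed.

(** The basis vector of [u], which is zero outside [P]. *)
Definition label_vec u : l2 R I := oapp (@l2_delta R I) 0 (insub u).

Lemma label_vecE u x : label_vec u x = (val x == u)%:R.
Proof.
rewrite /label_vec; case: insubP => [y _ <-|Pu] /=; first by rewrite l2_deltaE.
by rewrite l20; case: eqP => // xu; move: Pu; rewrite -xu (valP x).
Qed.

Lemma model_label_vec i (j : 'I_(n i)) u : model j (label_vec u) = label_vec (push j u).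
Proof.
apply: l2_eqP => x; rewrite modelE label_vecE eq_push; case: ifP => //= _.
have -> : pop i (val x) = val (Sub (pop i (val x)) (P_pop i (valP x)) : I) by [].
by rewrite ext0_val label_vecE.
Qed.

Lemma word_op_label_vec i (w : seq 'I_(n i)) u :
  word_op model w (label_vec u) = label_vec (set_word u (w ++ u.2 i)).
Proof.
elim: w => [|j w IH] /=; first by rewrite set_word_id.
by rewrite IH model_label_vec /push set_word_in set_word_twice.
Qed.

Definition push_words (r : seq 'I_k) (alpha : forall i, seq 'I_(n i)) u : label m n :=
  (u.1, [ffun i => if i \in r then alpha i ++ u.2 i else u.2 i]).

Lemma word_ops_label_vec (r : seq 'I_k) (alpha : forall i, seq 'I_(n i)) u : uniq r ->
  (\big[comp/id]_(i <- r) word_op model (alpha i)) (label_vec u) =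
  label_vec (push_words r alpha u).
Proof.
elim: r => [|i r IH] /=.
  by rewrite big_nil => _; congr label_vec; apply: label_eqP => // i; rewrite ffunE.
move=> /andP[ir ur]; rewrite big_cons /= IH // word_op_label_vec; congr label_vec.
apply: label_eqP => // j; rewrite [RHS]ffunE inE.
have [->|ji] := eqVneq j i; first by rewrite set_word_in ffunE (negbTE ir).
by rewrite set_word_out 1?eq_sym // ffunE.
Qed.

Lemma word_ops_linear (r : seq 'I_k) (alpha : forall i, seq 'I_(n i)) :
  linear (\big[comp/id]_(i <- r) word_op model (alpha i) : l2 R I -> l2 R I).
Proof.
apply: (big_ind (fun F : l2 R I -> l2 R I => linear F)) => //.
  by move=> F G lF lG a f g /=; rewrite lG lF.
move=> i _; elim: (alpha i) => [|j w IH] // a f g.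
rewrite -[LHS]/(pshift (creation j) (word_op model w (a *: f + g))) (IH a f g).
exact: linearP.
Qed.

(** The vectors in the range of the defect are combinations of vacua, and words
    map a vacuum to the basis vector of the label that they spell. *)
Lemma Mspan_model (q : 'I_k -> nat) (s : seq (label m n)) :
  (forall c, P (vacuum n c)) -> uniq s ->
  (forall u, (u \in s) = [forall i, (size (u.2 i) <= q i)%N]) ->
  Mspan model q =
  [set f | forall x, ~~ [forall i, (size ((val x).2 i) <= q i)%N] -> f x = 0].
Proof.
move=> Pv us; pose short (u : label m n) := [forall i, (size (u.2 i) <= q i)%N].
move=> sq; pose gens := [set f | exists2 u, short u & f = label_vec u].
have genE (alpha : forall i, seq 'I_(n i)) c :
    (\big[comp/id]_(i < k) word_op model (alpha i)) (label_vec (vacuum n c)) =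
    label_vec (c, [ffun i => alpha i]).
  rewrite word_ops_label_vec ?index_enum_uniq //; congr label_vec; apply: label_eqP => // i.
  by rewrite !ffunE mem_index_enum cats0.
transitivity (lin_span gens); apply/seteqP; split.
- apply: lin_span_sub => v [alpha [h [alphaq]]].
  rewrite model_defect range_proj => hP ->.
  have -> : h = \sum_c ext0 h (vacuum n c) *: label_vec (vacuum n c).
    apply: l2_eqP => x; rewrite l2_sum.
    have [/forallP x0|x0] := boolP [forall i, (val x).2 i == [::]].
      have xE : val x = vacuum n (val x).1.
        by apply: label_eqP => // i; rewrite ffunE; exact/eqP.
      rewrite (bigD1 (val x).1) //= -xE l2Z ext0_val label_vecE eqxx mulr1.
      rewrite big1 ?addr0 // => c cx; rewrite l2Z label_vecE.
      by case: eqP => [e|_]; [move: cx; rewrite e eqxx | rewrite mulr0].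
    rewrite hP // big1 // => c _; rewrite l2Z label_vecE.
    case: eqP => [e|_]; last by rewrite mulr0.
    by case/forallP: x0 => i; rewrite e ffunE.
  pose F : {linear l2 R I -> l2 R I} :=
    HB.pack (\big[comp/id]_(i < k) word_op model (alpha i) : l2 R I -> l2 R I)
      (GRing.isLinear.Build _ _ _ _ _ (word_ops_linear (index_enum 'I_k) alpha)).
  rewrite -[_ (\sum_c _)]/(F _) linear_sum.
  exists m, (fun c => ext0 h (vacuum n c)), (fun c => label_vec (c, [ffun i => alpha i])).
  split=> [c|]; last by apply: eq_bigr => c _; rewrite linearZ /= genE.
  by exists (c, [ffun i => alpha i]) => //; apply/forallP => i; rewrite ffunE.
- apply: lin_span_sub => v [u /forallP uq ->]; apply: lin_span_id.
  exists (fun i => u.2 i), (label_vec (vacuum n u.1)); split => //.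
    rewrite model_defect range_proj => x; rewrite label_vecE => x0.
    case: eqP => // e; case/forallP: x0 => i; rewrite e.
    by rewrite ffunE.
  by rewrite genE; congr label_vec; apply: label_eqP => // i; rewrite ffunE.
- move=> _ [d [c [t [gt ->]]]] x xq; rewrite l2_sum big1 // => i _; rewrite l2Z.
  have [u uq ->] := gt i; rewrite label_vecE; case: eqP => [e|_]; last by rewrite mulr0.
  by move: xq; rewrite e -/(short u) uq.
- move=> f fq; pose r : seq I := pmap insub s.
  have rP x : (x \in r) = short (val x) by rewrite mem_pmap_sub sq.
  have fr x : x \notin r -> f x = 0 by rewrite rP => /fq.
  rewrite (support_expansion (pmap_sub_uniq I us) fr).
  exists (size r), (fun i => f (tnth (in_tuple r) i)),
    (fun i => l2_delta R (tnth (in_tuple r) i)); split=> // i.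
  exists (val (tnth (in_tuple r) i)); first by rewrite -rP mem_tnth.
  by rewrite /label_vec valK.
Qed.

Lemma has_dim_Mspan (q : 'I_k -> nat) (s : seq (label m n)) :
  (forall c, P (vacuum n c)) -> uniq s ->
  (forall u, (u \in s) = [forall i, (size (u.2 i) <= q i)%N]) ->
  has_dim (Mspan model q) (count P s).
Proof.
move=> Pv us sq; rewrite (Mspan_model Pv us sq).
exact: (@has_dim_labels (fun u => [forall i, (size (u.2 i) <= q i)%N])).
Qed.

End Model.

(** * Counting the labels *)

Section Counting.
Variable R : realType.

(** The count is the ceiling of [x]. *)
Lemma card_below (M : nat) (x : R) : 0 <= x <= M%:R ->
  x <= (\sum_(v < M) (v%:R < x)%R)%:R <= x + 1.
Proof.
move=> /andP[x0 xM]; have [ax xa] := andP (truncn_itv x0).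
set a := Num.truncn x in ax xa.
(* [c] is the ceiling of [x]. *)
pose c := if a%:R < x then a.+1 else a.
have xc : x <= c%:R by rewrite /c; case: ltP => // _; rewrite ltW.
have cx : c%:R <= x + 1.
  by rewrite /c; case: ltP => _; rewrite -?natr1 ?lerD2r // ler_wpDr.
have cM : (c <= M)%N.
  rewrite /c; case: ltP => [ltax|_]; rewrite -(ler_nat R); last exact: le_trans ax xM.
  by rewrite ler_nat -(ltr_nat R); exact: lt_le_trans ltax xM.
have vc (v : nat) : (v%:R < x) = (v < c)%N.
  apply/idP/idP => [vx|].
    by rewrite -(ltr_nat R); exact: lt_le_trans vx xc.
  rewrite /c; case: ltP => [ltax|_]; last by rewrite -(ltr_nat R) => /lt_le_trans; exact.
  by rewrite ltnS -(ler_nat R) => /le_lt_trans; exact.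
have -> : (\sum_(v < M) (v%:R < x)%R = c)%N.
  under eq_bigr do rewrite vc.
  rewrite -big_mkcond /= (big_ord_narrow cM) /=.
  by rewrite sum1_card card_ord.
by rewrite xc cx.
Qed.

Section Digits.
Variables (N m : nat).
Implicit Type w : seq 'I_N.

(** The base [N] number with leading part [c] whose last digit is the head
    of [w]. *)
Definition digits c w : nat := foldr (fun (j : 'I_N) v => N * v + j)%N c w.

Lemma digits_ub c w : (c < m)%N -> (digits c w < m * N ^ size w)%N.
Proof.
move=> cm; elim: w => [|j w IH] /=; first by rewrite muln1.
rewrite expnS mulnCA; apply: (@leq_trans (N * (digits c w).+1)); last first.
  by rewrite leq_mul2l IH orbT.
by rewrite mulnS addnC ltn_add2r.
Qed.

Lemma digits_inj c c' w w' : size w = size w' -> digits c w = digits c' w' ->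
  c = c' /\ w = w'.
Proof.
elim: w w' => [|j w IH] [|j' w'] //= [sw] e.
have N0 : (0 < N)%N by exact: leq_ltn_trans (ltn_ord j).
have ej : val j = val j'.
  have := congr1 (modn^~ N) e.
  by rewrite ![(N * _)%N]mulnC !modnMDl !modn_small.
move: e => /=; rewrite -[nat_of_ord j]/(val j) ej => /addIn/eqP.
rewrite eqn_pmul2l // => /eqP e.
by have [-> ->] := IH _ sw e; rewrite (val_inj ej).
Qed.

(** The words of leading part [c] that, divided by the appropriate power of [N],
    lie below [t]. The last letter of a word is its most significant digit, so
    that deleting the first letter truncates the number and the set is closed
    under this deletion. The empty word is always admitted, which keeps all [m]
    vacuum vectors. *)
Definition below (t : R) c w : bool :=
  (w == [::]) || ((digits c w)%:R < t * N%:R ^+ size w).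

Lemma below_behead t c w : below t c w -> below t c (behead w).
Proof.
case: w => [|j w] //=; rewrite /below /=; case: (altP (w =P [::])) => //= _.
have N0 : (0 < N)%N by exact: leq_ltn_trans (ltn_ord j).
have N0' : 0 < N%:R :> R by rewrite ltr0n.
move=> h; rewrite -(ltr_pM2l N0') mulrCA -exprS; apply: le_lt_trans h.
by rewrite -natrM ler_nat leq_addr.
Qed.

(** Reading a leading part and a word of length [l] as one number identifies the
    pairs with the integers below [m * N ^ l]. *)
Lemma card_below_level (t : R) l :
  let s := (\sum_(c < m) \sum_(w : l.-tuple 'I_N) ((digits c w)%:R < t * N%:R ^+ l)%R)%N in
  0 <= t <= m%:R ->
  t * N%:R ^+ l <= s%:R <= t * N%:R ^+ l + 1.
Proof.
move=> s /andP[t0 tm].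
have dlt (p : 'I_m * l.-tuple 'I_N) : (digits p.1 p.2 < m * N ^ l)%N.
  by have := digits_ub p.2 (ltn_ord p.1); rewrite size_tuple.
pose h p := Ordinal (dlt p).
have h_inj : injective h.
  move=> [c w] [c' w'] [] /digits_inj[]; first by rewrite !size_tuple.
  by move=> /val_inj -> /val_inj ->.
have h_bij : bijective h.
  by apply: inj_card_bij h_inj _; rewrite card_prod card_tuple !card_ord.
have -> : s = (\sum_(v < m * N ^ l) (v%:R < t * N%:R ^+ l)%R)%N.
  rewrite /s pair_big (reindex h) /=; first by [].
  exact: onW_bij.
apply: card_below.
by rewrite mulr_ge0 ?exprn_ge0 // natrM natrX ler_wpM2r // exprn_ge0.
Qed.

Definition wordsle (q : nat) : finType := {l : 'I_q.+1 & l.-tuple 'I_N}.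
Definition word_of q (b : wordsle q) : seq 'I_N := tagged b.

Lemma card_wordsle q : #|{: wordsle q}| = (\sum_(l < q.+1) N ^ l)%N.
Proof.
rewrite card_tagged sumnE big_map big_enum /=; apply: eq_bigr => l _.
by rewrite card_tuple card_ord.
Qed.

Lemma word_of_inj q : injective (@word_of q).
Proof.
move=> [l w] [l' w'] /= e.
have ll' : l = l'.
  by apply: val_inj; have := congr1 size e; rewrite /word_of /= !size_tuple.
subst l'; congr existT; exact: val_inj.
Qed.

Lemma word_ofP q w : reflect (exists b : wordsle q, word_of b = w) (size w <= q)%N.
Proof.
apply: (iffP idP) => [wq|[[l b] <-]]; last by rewrite /word_of size_tuple -ltnS.
have lt : (size w < q.+1)%N by [].
by exists (existT (fun l : 'I_q.+1 => l.-tuple 'I_N) (Ordinal lt) (in_tuple w)).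
Qed.

(** Summing the levels, each contributes at most one more than the fraction [t]
    of all words, and the level of the empty words contributes at most [m]. *)
Lemma card_below_wordsle (t : R) q :
  let s := (\sum_(c < m) \sum_(b : wordsle q) below t c (word_of b))%N in
  let L := (\sum_(l < q.+1) N ^ l)%N in
  0 <= t <= m%:R ->
  t * L%:R <= s%:R <= t * L%:R + (m + q)%:R.
Proof.
move=> s L tm.
have -> : s = (m + \sum_(l < q) \sum_(c < m) \sum_(w : l.+1.-tuple 'I_N)
    ((digits c w)%:R < t * N%:R ^+ l.+1)%R)%N.
  rewrite /s.
  have E (c : 'I_m) : (\sum_(b : wordsle q) below t c (word_of b) =
      \sum_(l < q.+1) \sum_(w : l.-tuple 'I_N) below t c w)%N.
    exact/esym/(sig_big_dep predT (fun _ => predT)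
      (fun (l : 'I_q.+1) (w : l.-tuple 'I_N) => (below t c w : nat))).
  under eq_bigr do rewrite E.
  rewrite exchange_big big_ord_recl /=; congr (_ + _)%N.
    transitivity (\sum_(c < m) 1)%N; last by rewrite sum1_card card_ord.
    apply: eq_bigr => c _; rewrite (eq_bigr (fun=> 1%N)) => [|w _].
      by rewrite sum1_card card_tuple.
    by rewrite /below -size_eq0 size_tuple.
  apply: eq_bigr => l _; apply: eq_bigr => c _; apply: eq_bigr => w _.
  by rewrite /below size_tuple; case/tupleP: w.
have -> : L%:R = 1 + \sum_(l < q) N%:R ^+ l.+1 :> R.
  rewrite natr_sum big_ord_recl /=; congr (_ + _).
  by apply: eq_bigr => l _; rewrite natrX.
have /andP[t0 tm'] := tm.
rewrite natrD natr_sum mulrDr mulr1 mulr_sumr.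
apply/andP; split.
  apply: lerD => //; apply: ler_sum => l _.
  by have /andP[] := card_below_level l.+1 tm.
apply: (@le_trans _ _ (m%:R + \sum_(l < q) (t * N%:R ^+ l.+1 + 1))).
  rewrite lerD2l; apply: ler_sum => l _.
  by have /andP[] := card_below_level l.+1 tm.
rewrite big_split /= sumr_const card_ord natrD.
by rewrite -subr_ge0; set A := \sum_(i < q) _; rewrite [leRHS](_ : _ = t) //; ring.
Qed.

End Digits.
End Counting.

Section BoundedLabels.
Variables (k m : nat) (n : 'I_k -> nat) (q : 'I_k -> nat).

Definition label_of (a : 'I_m * {dffun forall i, wordsle (n i) (q i)}) :
  label m n := (a.1, [ffun i => word_of (a.2 i)]).

Definition bounded_labels : seq (label m n) := map label_of (enum predT).

Lemma bounded_labels_uniq : uniq bounded_labels.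
Proof.
rewrite map_inj_uniq ?enum_uniq // => -[c a] [d b] [-> ab].
congr pair; apply/ffunP => i; apply: word_of_inj.
by have /ffunP/(_ i) := ab; rewrite !ffunE.
Qed.

Lemma mem_bounded_labels (u : label m n) :
  (u \in bounded_labels) = [forall i, (size (u.2 i) <= q i)%N].
Proof.
apply/mapP/forallP => [[a _ ->] i|uq].
  by apply/word_ofP; rewrite ffunE; exists (a.2 i).
have a i := cid (elimT (word_ofP _ _) (uq i)).
exists (u.1, [ffun i => projT1 (a i)] : {dffun forall i, wordsle (n i) (q i)}).
  by rewrite mem_enum.
by apply: label_eqP => // i; rewrite !ffunE; case: (a i).
Qed.

(** The restriction [B i0] only concerns the coordinate [i0], so the other
    coordinates contribute the factor that also appears in the denominator of the
    Euler ratio. [B] is a family over all coordinates to avoid casts. *)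
Lemma count_bounded_labels (i0 : 'I_k) (B : forall i, 'I_m -> seq 'I_(n i) -> bool) :
  count (fun u : label m n => B i0 u.1 (u.2 i0)) bounded_labels =
  ((\sum_(c < m) \sum_(b : wordsle (n i0) (q i0)) B i0 c (word_of b)) *
   \prod_(i | i != i0) \sum_(l < (q i).+1) n i ^ l)%N.
Proof.
pose C c i : pred (wordsle (n i) (q i)) :=
  fun b => (i == i0) ==> B i c (word_of b).
rewrite count_map -sum1_count big_enum_cond /=.
transitivity (\sum_(c < m) \sum_(a : {dffun forall i, wordsle (n i) (q i)} |
    B i0 c (word_of (a i0))) 1)%N.
  by rewrite pair_big_dep; apply: eq_bigl => -[c a] /=; rewrite ffunE.
rewrite big_distrl /=; apply: eq_bigr => c _.
transitivity #|(family (C c) : simpl_pred {dffun forall i, wordsle (n i) (q i)})|.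
  rewrite -sum1_card; apply: eq_bigl => a; apply/idP/familyP => [h i|/(_ i0)].
    by apply/implyP => /eqP ->.
  by rewrite /in_mem /= /C eqxx.
rewrite card_family foldrE big_map big_enum /= (bigD1 i0) //=; congr (_ * _)%N.
  rewrite -sum1_card big_mkcond; apply: eq_bigr => b _.
  by rewrite /in_mem /= /C eqxx; case: (B i0 c _).
apply: eq_bigr => i /negbTE ii0; rewrite -card_wordsle.
by apply: eq_card => b; rewrite /in_mem /= /C ii0.
Qed.

End BoundedLabels.

Section Limit.
Variable R : realType.

Lemma geometric_sum_ge (N q : nat) : (1 < N)%N ->
  (q.+1 ^ 2 <= 2 * \sum_(l < q.+1) N ^ l)%N.
Proof.
move=> N1; elim: q => [|q IH]; first by rewrite big_ord_recl big_ord0.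
rewrite big_ord_recr /= mulnDr.
apply: leq_trans (leq_add IH (leqnn _)).
have := ltn_expl q.+1 N1; set e := (N ^ q.+1)%N => qe.
by rewrite !expnS !expn0; nia.
Qed.

(** The error [m + q] is linear in [q], while the sum of the powers of [N] is at
    least quadratic. *)
Lemma ratio_cvg (N m : nat) (t : R) (s : nat -> nat) (Q : nat -> nat) :
  (1 < N)%N ->
  (forall q, t * (\sum_(l < q.+1) N ^ l)%:R <= (s q)%:R
               <= t * (\sum_(l < q.+1) N ^ l)%:R + (m + q)%:R) ->
  (forall r, \forall M \near \oo, (r <= Q M)%N) ->
  (s (Q M))%:R / (\sum_(l < (Q M).+1) N ^ l)%:R @[M --> \oo] --> t.
Proof.
move=> N1 sP Qoo; apply/cvgrPdist_lt => e e0.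
pose r := Num.truncn (2 * m.+1%:R / e).
have rP : 2 * m.+1%:R < e * r.+1%:R.
  rewrite [e * _]mulrC -ltr_pdivrMr //.
  have /truncn_itv/andP[] : 0 <= 2 * m.+1%:R / e :> R.
    by rewrite divr_ge0 ?mulr_ge0 ?ler0n // ltW.
  by [].
apply: filterS (Qoo r) => M /=; move: (Q M) => q rq.
have := sP q; have := geometric_sum_ge q N1.
set L0 := (\sum_(l < q.+1) _)%N => L0q /= /andP[tL Lt].
have L0' : 0 < L0%:R :> R by rewrite ltr0n; lia.
rewrite distrC ger0_norm; last by rewrite subr_ge0 ler_pdivlMr.
rewrite ltrBlDr ltr_pdivrMr // mulrDl addrC.
apply: le_lt_trans Lt _; rewrite ltrD2l.
rewrite -(ltr_pM2l (ltr0n R 2)).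
have h1 : (m + q)%:R <= m.+1%:R * q.+1%:R :> R by rewrite -natrM ler_nat; nia.
have h2 : q.+1%:R ^+ 2 <= 2 * L0%:R :> R by rewrite -natrX -natrM ler_nat.
have h3 : r.+1%:R <= q.+1%:R :> R by rewrite ler_nat.
have q0 : 0 < q.+1%:R :> R by rewrite ltr0n.
apply: (@le_lt_trans _ _ (2 * m.+1%:R * q.+1%:R)); first by rewrite -mulrA ler_pM2l.
apply: (@lt_le_trans _ _ (e * r.+1%:R * q.+1%:R)); first by rewrite ltr_pM2r.
apply: (@le_trans _ _ (e * q.+1%:R ^+ 2)).
  by rewrite expr2 -mulrA ler_pM2l // ler_pM2r.
by rewrite [leRHS]mulrCA ler_pM2l.
Qed.

End Limit.

(** * The range of the Euler characteristic *)

Theorem mainTheorem12 (R : realType) (k : nat) (n : 'I_k -> nat)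
    (k_gt0 : (0 < k)%N) (n_ge2 : forall i : 'I_k, (2 <= n i)%N) :
  (forall (m : nat) (t : R), (0 < m)%N -> 0 <= t <= m%:R ->
     exists (H : hilbertType R) (T : opTuple H n),
       [/\ polyball T, pure T, finite_rank T, rank T = m & euler_char_is T t])
  /\
  [set t : R | exists (H : hilbertType R) (X : opTuple H n),
     [/\ polyball X, finite_rank X & euler_char_is X t]]
  = [set t : R | 0 <= t].
Proof.
have attained (m : nat) (t : R) : (0 < m)%N -> 0 <= t <= m%:R ->
    exists (H : hilbertType R) (T : opTuple H n),
      [/\ polyball T, pure T, finite_rank T, rank T = m & euler_char_is T t].
  move=> m_gt0 tm.
  (* Only the words of the first coordinate are restricted. *)
  pose i0 : 'I_k := Ordinal k_gt0.
  pose B (i : 'I_k) (c : 'I_m) (w : seq 'I_(n i)) := below t c w.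
  pose P : pred (label m n) := fun u => B i0 u.1 (u.2 i0).
  have P_pop i u : P u -> P (pop i u).
    rewrite /P /pop; have [<-|ii0] := eqVneq i i0; last by rewrite set_word_out.
    by rewrite set_word_in; exact: below_behead.
  have P_vacuum c : P (vacuum n c) by rewrite /P /B /below ffunE.
  have dim_defect := has_dim_defect R P_pop P_vacuum.
  exists (l2_hilbert R {u : label m n | P u}), (model R P); split.
  - exact: model_polyball.
  - exact: model_pure.
  - by exists m.
  - exact: lin_dimE.
  move=> q [q_mono q_cofinal].
  pose s (Q : nat) := (\sum_(c < m) \sum_(b : wordsle (n i0) Q) B i0 c (word_of b))%N.
  have ratioE M : euler_ratio (model R P) (q M) =
      (s (q M i0))%:R / (\sum_(l < (q M i0).+1) n i0 ^ l)%:R.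
    have dimM := has_dim_Mspan R P_pop P_vacuum
      (@bounded_labels_uniq k m n (q M)) (@mem_bounded_labels k m n (q M)).
    rewrite /euler_ratio (lin_dimE dimM) (@count_bounded_labels k m n (q M) i0 B).
    rewrite natrM natr_prod.
    rewrite [X in _ / X](bigD1 i0) //=.
    have LE i : \sum_(j < (q M i).+1) (n i)%:R ^+ j =
        (\sum_(l < (q M i).+1) n i ^ l)%:R :> R.
      by rewrite natr_sum; apply: eq_bigr => j _; rewrite natrX.
    rewrite LE; under [X in _ / (_ * X)]eq_bigr do rewrite LE.
    rewrite -mulf_div divff ?mulr1 //.
    apply/prodf_neq0 => i _; rewrite pnatr_eq0 -lt0n big_ord_recl expn0.
    exact: ltn_addr.
  under eq_fun do rewrite ratioE.
  apply: (@ratio_cvg R (n i0) m t s (fun M => q M i0)) => // [Q|r].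
    exact: card_below_wordsle.
  have [M0 M0P] := q_cofinal (fun=> r).
  exists M0 => // M /= M0M; apply: leq_trans (M0P i0) _.
  elim: M M0M => [|M IH]; first by rewrite leqn0 => /eqP ->.
  rewrite leq_eqVlt ltnS => /predU1P[->|/IH qM] //.
  exact: leq_trans qM (q_mono _ _).
split=> //; apply/seteqP; split=> t /=.
  move=> [H [X [_ _ /(_ (fun M _ => M))]]] Xt.
  apply: (cvgr_to_ge (Xt _)).
    split=> [M i|r]; first exact: leqnSn.
    by exists (\max_i r i)%N => i; exact: leq_bigmax.
  apply: nearW => M; rewrite divr_ge0 ?ler0n //.
  by apply: prodr_ge0 => i _; apply: sumr_ge0 => j _; rewrite exprn_ge0.
move=> t0; have /andP[_ /ltW tm] := truncn_itv t0.
(* Any integer above [t] will do as the rank. *)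
have [|H [T [? _ ? _ ?]]] := attained _ t (ltn0Sn (Num.truncn t)).
  by rewrite t0 tm.
by exists H, T; split.
Qed.
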